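(* For all $k\le\binom n2$, $$R(\mathcal A_k,\mathcal X)\;\ge\;\frac12-\frac{k}{(n-1)^2}.$$ In particular, $R(\mathcal A_k,\mathcal X)\ge 1/2-o(1)$ whenever $k=o(n^2)$.
   Context: For a symmetric positive definite $n\times n$ matrix $\Sigma$ (a covariance matrix) with $K=\Sigma^{-1}$, the concentration graph is the graph on the $n$ indices with an edge $ij$ ($i\ne j$) iff $K_{ij}\ne0$. $\mathcal X$ is the class of $n\times n$ covariance matrices whose concentration graph is a tree; for $\Sigma\in\mathcal X$, $T(\Sigma)$ denotes this tree. A covariance oracle returns, on input a pair of indices $(i,j)$, the entry $\Sigma_{ij}$. $\mathcal A_k$ is the class of all randomized adaptive algorithms that query the covariance oracle at most $k$ times (adaptive means that the algorithms are allowed to choose their queries dynamically). An algorithm $A\in\mathcal A_k$ outputs a tree $\mathcal T(A)$. For $\Sigma\in\mathcal X$ let $P(A,\Sigma)=\mathbb P\{\mathcal T(A)\ne T(\Sigma)\}$, where the probability is with respect to the randomization of the algorithm $A$ (run with the oracle for $\Sigma$). The minimax risk is $R(\mathcal A_k,\mathcal X)=\inf_{A\in\mathcal A_k}\sup_{\Sigma\in\mathcal X}P(A,\Sigma)$. The $o(\cdot)$ notation refers to $n\to\infty$.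
   Formalization: The bound is stated for n ≥ 2 with (n,k) ≠ (2,0): at n = 1 the right-hand side is 0/0, at n = 0 there are no trees, and at n = 2, k = 0 there is only one tree, so the risk is 0 and the claimed bound 1/2 fails. *)

(* Defs.v *)
From HB Require Import structures.
From mathcomp Require Import all_boot all_order all_algebra.
From mathcomp Require Import all_classical all_reals all_analysis.
Set Implicit Arguments.
Unset Strict Implicit.
Unset Printing Implicit Defensive.
Import Order.TTheory GRing.Theory Num.Theory.
Import numFieldNormedType.Exports.

Local Open Scope classical_set_scope.
Local Open Scope ring_scope.

(* A graph on {0, ..., n-1} is given by its set of ordered adjacent pairs. *)
Definition graph (n : nat) := {set 'I_n * 'I_n}.

Definition adj (n : nat) (G : graph n) : rel 'I_n := [rel i j | (i, j) \in G].

(* In a symmetric irreflexive graph, the simple closed walks of size at least 3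
   are exactly the cycles; those of size 2 traverse one edge back and forth. *)
Definition is_tree (n : nat) (G : graph n) : Prop :=
  [/\ (0 < n)%N,
      symmetric (adj G) /\ irreflexive (adj G),
      forall i j, connect (adj G) i j
    & ~ exists2 s : seq 'I_n, (2 < size s)%N & ucycle (adj G) s].

Record tree (n : nat) := Tree {
  tree_graph :> graph n;
  tree_graphP : is_tree tree_graph }.

Section Covariance.
Variable R : realType.

Definition sym_posdef (n : nat) (S : 'M[R]_n) : Prop :=
  S^T = S /\ forall x : 'cV[R]_n, x != 0 -> 0 < (x^T *m S *m x) 0 0.

Definition concentration_graph (n : nat) (S : 'M[R]_n) : graph n :=
  [set ij : 'I_n * 'I_n | (ij.1 != ij.2) && (invmx S ij.1 ij.2 != 0)]%SET.

Definition tree_covariance (n : nat) : set 'M[R]_n :=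
  [set S | sym_posdef S /\ is_tree (concentration_graph S)].

(* A deterministic adaptive algorithm: each query may depend on all previous
   answers.  Queries with i = j (variances) are allowed and counted. *)
Inductive strategy (n : nat) : Type :=
| Output of tree n
| Query of 'I_n & 'I_n & (R -> strategy n).

Fixpoint output (n : nat) (S : 'M[R]_n) (s : strategy n) : tree n :=
  match s with
  | Output t => t
  | Query i j next => output S (next (S i j))
  end.

Fixpoint queries (n : nat) (S : 'M[R]_n) (s : strategy n) : nat :=
  match s with
  | Output _ => 0%N
  | Query i j next => (queries S (next (S i j))).+1
  end.

(* All the randomness is drawn beforehand as a seed in an arbitrary probability
   space, so that randomization interleaved with the queries is covered.  The
   only measurability asked for is that the output be a (discrete) random
   element for each admissible covariance matrix. *)
Record rand_algorithm (n : nat) := RandAlgorithm {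
  seed_display : measure_display;
  seed : measurableType seed_display;
  seed_law : probability seed R;
  strategy_of : seed -> strategy n;
  output_measurable : forall S : 'M[R]_n, tree_covariance S ->
    forall G : graph n,
      measurable [set w | tree_graph (output S (strategy_of w)) = G] }.

(* A predicate rather than a [set], for universe reasons: algorithms range over
   all probability spaces. *)
Definition algorithm_class (n k : nat) (A : rand_algorithm n) : Prop :=
  forall (w : seed A) (S : 'M[R]_n), tree_covariance S ->
    (queries S (strategy_of w) <= k)%N.

Definition error_prob (n : nat) (A : rand_algorithm n) (S : 'M[R]_n) : \bar R :=
  seed_law A [set w | tree_graph (output S (strategy_of w))
                        <> concentration_graph S].

Definition max_risk (n : nat) (A : rand_algorithm n) : \bar R :=
  ereal_sup [set error_prob A S | S in @tree_covariance n].

Definition minimax_risk (n k : nat) : \bar R :=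
  ereal_inf [set r | exists2 A : rand_algorithm n,
                       algorithm_class k A & r = max_risk A].

End Covariance.

(* Main.v *)
Require Import Defs.
From HB Require Import structures.
From mathcomp Require Import all_boot all_order all_algebra.
From mathcomp Require Import all_classical all_reals all_analysis.
From mathcomp Require Import measurable_realfun.
From mathcomp Require Import zify ring lra.

(* By Yao's principle it suffices to average the error of a deterministic
   strategy over a prior.  Put [m = n - 1].  The star with an unknown centre [c]
   has all covariances 1, variance 1 at [c] and [l + 2] at the leaves [l]; moving
   a leaf [i] from [c] to a leaf [j < i] only changes the entry [(i, j)].  A
   strategy that is right on the star with centre [c] is therefore wrong on every
   such modification whose entry it did not query there.  Stars with distinct
   centres [c], [c'] differ only in two diagonal entries, so a strategy right on
   both must query [(c', c')] on the first or [(c, c)] on the second: being right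
   on [a] stars wastes at least [a (a - 1) / 2] queries on the diagonal.  With
   weight 1/2 on the stars, these wasted queries turn the denominator
   [m (m - 1)], obtained for a known centre, into [m ^ 2]. *)

Set Implicit Arguments.
Unset Strict Implicit.
Unset Printing Implicit Defensive.
Import Order.TTheory GRing.Theory Num.Theory.
Import numFieldNormedType.Exports.
Local Open Scope classical_set_scope.
Local Open Scope ring_scope.

(** * Trees described by a parent map *)

Definition parent_graph (n : nat) (par : 'I_n -> 'I_n) : graph n :=
  [set ab : 'I_n * 'I_n
    | (ab.1 != ab.2) && ((par ab.1 == ab.2) || (par ab.2 == ab.1))]%SET.

(** The height [h] decreases strictly along [par], so iterating [par] from any vertex ends at the
    root [c]; a cycle breaks down at its highest vertex. *)
Lemma parent_graph_tree (n : nat) (c : 'I_n) (par : 'I_n -> 'I_n)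
    (h : 'I_n -> nat) :
  par c = c -> (forall l, l != c -> (h (par l) < h l)%N) ->
  is_tree (parent_graph par).
Proof.
move=> parc hpar.
have adjE a b : adj (parent_graph par) a b =
    (a != b) && ((par a == b) || (par b == a)) by rewrite /adj /= inE.
have adj_sym : symmetric (adj (parent_graph par)).
  by move=> a b; rewrite !adjE eq_sym orbC.
have to_root a : connect (adj (parent_graph par)) a c.
  move: {2}(h a) (leqnn (h a)) => d; elim: d a => [|d IH] a ha.
    case: (eqVneq a c) => [->|/hpar]; first exact: connect0.
    by move: ha; rewrite leqn0 => /eqP->.
  case: (eqVneq a c) => [->|ac]; first exact: connect0.
  have hlt := hpar a ac.
  apply: (connect_trans (y := par a)).
    apply: connect1; rewrite adjE eqxx andbT.
    by apply: contraTneq hlt => <-; rewrite ltnn.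
  by apply: IH; rewrite -ltnS (leq_trans hlt).
split.
- by case: n c {par h hpar parc adjE adj_sym to_root} => // -[].
- by split=> // a; rewrite adjE eqxx.
- move=> i j; apply: (connect_trans (to_root i)).
  by rewrite (sym_connect_sym adj_sym).
- case=> s s2 ucs.
  have [x0 x0s] : exists x0, x0 \in s.
    by case: s s2 {ucs} => // x s; exists x; rewrite mem_head.
  (* Both cycle neighbours of a vertex of maximal height are its parent. *)
  case: (@arg_maxnP _ x0 (mem s) h x0s) => x xs xmax.
  have up y : y \in s -> adj (parent_graph par) x y -> y = par x.
    move=> ys; rewrite adjE => /andP[xy] /orP[/eqP//|/eqP yx].
    have /hpar : y != c.
      by apply: contraNneq xy => yc; rewrite -yx yc parc.
    by rewrite yx ltnNge => /negP[]; exact: xmax.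
  have [i s' sE] := rot_to xs.
  move: ucs; rewrite -(rot_ucycle i) sE => /andP[].
  have ms y : y \in x :: s' -> y \in s by rewrite -sE mem_rot.
  have : (2 < size (x :: s'))%N by rewrite -sE size_rot.
  case: s' {sE} ms => // y t; case/lastP: t => // t z ms _ /=.
  rewrite rcons_path last_rcons => /and3P[xy _ zx].
  have yE : y = par x by apply: up => //; apply: ms; rewrite !inE eqxx orbT.
  have zE : z = par x.
    apply: up; last by rewrite adj_sym.
    by apply: ms; rewrite !inE mem_rcons mem_head !orbT.
  by rewrite yE zE mem_rcons mem_head andbF.
Qed.

(** * Covariances of tree models with uncorrelated innovations *)

Section TreeModel.
Variables (R : realType) (n : nat) (c : 'I_n) (par : 'I_n -> 'I_n).
Variables (v : 'I_n -> R) (S : 'M[R]_n).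
Hypothesis parc : par c = c.
Hypothesis v_gt0 : forall l, 0 < v l.

(* Row [l] of [innov] sends a vector [X] to the innovation [X_l - X_(par l)],
   and to [X_c] at the root. *)
Let innov : 'M[R]_n :=
  \matrix_(l, a) ((l == a)%:R - ((l != c) && (par l == a))%:R).

(** Entrywise form of the identity [innov_diag]: the innovations are uncorrelated, with variances
    [v]. *)
Hypothesis innov_cov : forall l b,
  S l b - (l != c)%:R * S (par l) b - (b != c)%:R * S l (par b)
    + (l != c)%:R * (b != c)%:R * S (par l) (par b) = v l *+ (l == b).

Let sum_delta (l : 'I_n) (F : 'I_n -> R) : \sum_a (l == a)%:R * F a = F l.
Proof.
rewrite (bigD1 l) //= eqxx mul1r big1 ?addr0 // => a al.
by rewrite eq_sym (negbTE al) mul0r.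
Qed.

Let sum_innov (l : 'I_n) (F : 'I_n -> R) :
  \sum_a innov l a * F a = F l - (l != c)%:R * F (par l).
Proof.
rewrite -[in RHS](sum_delta l) -[F (par l)]sum_delta mulr_sumr -sumrB.
apply: eq_bigr => a _; rewrite mxE mulrBl -mulnb natrM; ring.
Qed.

Let innov_diag : innov *m S *m innov^T = diag_mx (\row_l v l).
Proof.
apply/matrixP => l b; rewrite !mxE.
have E a : (innov *m S) l a = S l a - (l != c)%:R * S (par l) a.
  by rewrite mxE sum_innov.
transitivity (\sum_a innov b a * (S l a - (l != c)%:R * S (par l) a)).
  by apply: eq_bigr => a _; rewrite E [innov^T _ _]mxE mulrC.
by rewrite sum_innov -innov_cov; ring.
Qed.

Let det_diag : \det (diag_mx (\row_l v l)) \is a GRing.unit.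
Proof.
rewrite det_diag unitfE prodf_seq_neq0; apply/allP => l _.
by rewrite mxE gt_eqF.
Qed.

(** The determinants in [innov_diag] multiply to a unit, so each factor is invertible. *)
Let unit_innov : innov \in unitmx.
Proof.
move: det_diag; rewrite -innov_diag !det_mulmx !unitrM.
by rewrite unitmxE => /andP[/andP[]].
Qed.

Let unit_S : S \in unitmx.
Proof.
move: det_diag; rewrite -innov_diag !det_mulmx !unitrM.
by rewrite unitmxE => /andP[/andP[]].
Qed.

(** In the coordinates [y] with [x = innov^T *m y], the quadratic form is a sum of squares with
    weights [v l]. *)
Lemma tree_model_posdef : S^T = S -> sym_posdef S.
Proof.
move=> Ssym; split=> // x x0.
have uT : innov^T \in unitmx by rewrite unitmx_tr.
pose y := invmx innov^T *m x.
have xE : x = innov^T *m y by rewrite /y mulKVmx.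
have y0 : y != 0 by apply: contraNneq x0 => y0; rewrite xE y0 mulmx0.
have -> : x^T *m S *m x = y^T *m diag_mx (\row_l v l) *m y.
  by rewrite -innov_diag xE trmx_mul trmxK !mulmxA.
rewrite mxE.
have E l : (y^T *m diag_mx (\row_l v l)) 0 l * y l 0 = v l * y l 0 ^+ 2.
  by rewrite mul_mx_diag !mxE; ring.
under eq_bigr do rewrite E.
have /cV0Pn[l yl] := y0.
rewrite (bigD1 l) //= ltr_pwDl //.
  by rewrite mulr_gt0 // exprn_even_gt0.
by apply: sumr_ge0 => i _; rewrite mulr_ge0 ?sqr_ge0 // ltW.
Qed.

Let invS : invmx S = innov^T *m diag_mx (\row_l (v l)^-1) *m innov.
Proof.
apply: (can_inj (mulKmx unit_S)); rewrite mulmxV // !mulmxA.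
apply: (can_inj (mulKmx unit_innov)); rewrite mulmx1 !mulmxA innov_diag.
rewrite mulmx_diag (_ : diag_mx _ = 1%:M) ?mul1mx //.
apply/matrixP => a b; rewrite !mxE mulfV ?lt0r_neq0 //.
Qed.

Let invS_entry a b : a != b ->
  invmx S a b = - (((a != c) && (par a == b))%:R / v a
                   + ((b != c) && (par b == a))%:R / v b).
Proof.
move=> ab; rewrite invS mxE.
have E l : (innov^T *m diag_mx (\row_l (v l)^-1)) a l * innov l b =
    (a == l)%:R * ((v l)^-1 * innov l b)
    - (b == l)%:R * (((l != c) && (par l == a))%:R / v l).
  rewrite mul_mx_diag !mxE [a == l]eq_sym [b == l]eq_sym.
  (* No vertex has two parents, so a vertex [l] other than [a] and [b] contributes nothing to this
     entry of the inverse. *)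
  have PQ : ((l != c) && (par l == a))%:R * ((l != c) && (par l == b))%:R = 0 :> R.
    rewrite -natrM mulnb; case: (eqVneq (par l) a) => [->|_]; last by rewrite andbF.
    by rewrite (negbTE ab) !andbF.
  move: PQ; set P := (_ && _)%:R; set Q := (_ && _)%:R => PQ.
  rewrite (_ : forall A B V : R,
    (A - P) * V * (B - Q) = A * (V * (B - Q)) - B * (P * V) + V * (P * Q)).
    by rewrite PQ mulr0 addr0.
  by move=> A B V; ring.
under eq_bigr do rewrite E.
by rewrite sumrB !sum_delta mxE (negbTE ab) mulr0n sub0r; ring.
Qed.

(** The two terms in [invS_entry] carry the same sign, so they cannot cancel, even if [a] and [b]
    were parents of each other. *)
Lemma tree_model_graph : concentration_graph S = parent_graph par.
Proof.
apply/setP => -[a b]; rewrite !inE /=.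
have [//|ab /=] := eqVneq a b; rewrite invS_entry // oppr_eq0.
have drop x y : x != y -> (x != c) && (par x == y) = (par x == y).
  by case: (eqVneq x c) => //= -> cy; rewrite parc (negbTE cy).
have ba : b != a by rewrite eq_sym.
rewrite !drop //.
case: (par a == b); case: (par b == a) => /=;
  rewrite ?mulr0n ?mulr1n ?mul0r ?mul1r ?addr0 ?add0r ?eqxx //;
  by rewrite lt0r_neq0 ?addr_gt0 ?invr_gt0.
Qed.

End TreeModel.

(** * The stars and their one-leaf modifications *)

(* The star with centre [c] is [pair_cov c (c, c)]; for a pair [e = (j, i)] of
   leaves with [j < i], the leaf [i] is moved from [c] to [j], which changes the
   single covariance [Cov(i, j)]. *)
Definition pair_parent (n : nat) (c : 'I_n) (e : 'I_n * 'I_n) (l : 'I_n) :=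
  if l == e.2 then e.1 else c.

Definition pair_cov (R : realType) (n : nat) (c : 'I_n) (e : 'I_n * 'I_n) :
    'M[R]_n :=
  \matrix_(a, b) if a == b then (if a == c then 1 else (a.+2)%:R)
    else if ((a, b) == e) || ((b, a) == e) then (e.1.+2)%:R else 1.

Definition leaf_pair (n : nat) (c : 'I_n) (e : 'I_n * 'I_n) : bool :=
  [&& (e.1 < e.2)%N, e.1 != c & e.2 != c].

Section PairCov.
Variables (R : realType) (n : nat) (c : 'I_n) (e : 'I_n * 'I_n).
Hypothesis ce : (e == (c, c)) || leaf_pair c e.

Let pair_parent_root : pair_parent c e c = c.
Proof.
rewrite /pair_parent; case/orP: ce => [/eqP->|/and3P[_ _ ec]] /=.
  by rewrite eqxx.
by rewrite eq_sym (negbTE ec).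
Qed.

(** A leaf [l] attached to [c] keeps [(l + 2) - 1]. The moved leaf [i] has covariance [j + 2] with
    its new parent [j] and keeps [(i + 2) - (j + 2) = i - j]. Leaf variances increase with the index
    so that this is positive for [j < i]. *)
Let innovation_var (l : 'I_n) : R :=
  if l == c then 1 else if l == e.2 then (e.2 - e.1)%:R else l.+1%:R.

Let innovation_var_gt0 l : 0 < innovation_var l.
Proof.
rewrite /innovation_var; case: eqVneq => // lc; case: eqVneq => // le.
rewrite ltr0n subn_gt0; case/orP: ce => [/eqP eE|/and3P[]//].
by rewrite le eE eqxx in lc.
Qed.

Let pair_cov_innov l b :
  let S := pair_cov R c e in let par := pair_parent c e in
  S l b - (l != c)%:R * S (par l) b - (b != c)%:R * S l (par b)
    + (l != c)%:R * (b != c)%:R * S (par l) (par b)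
  = innovation_var l *+ (l == b).
Proof.
rewrite /= !mxE /innovation_var /pair_parent.
case/orP: ce => [/eqP->|]; rewrite /= ?xpair_eqE.
  rewrite !if_same.
  case: (eqVneq l b) => [<-|lb]; case: (eqVneq l c) => [lE|_];
    case: (eqVneq b c) => [bE|_]; rewrite ?eqxx /= ?andbF;
    rewrite ?mulr0n ?mulr1n; try ring.
  by case/eqP: lb; rewrite lE bE.
case: e => j i /and3P[/= ji jc ic]; rewrite ?xpair_eqE.
have ij : i != j by apply: contraTneq ji => ->; rewrite ltnn.
have cE := (eq_sym c j, eq_sym c i, eq_sym j i, negbTE jc, negbTE ic, negbTE ij).
case: (eqVneq l b) => [<-{b}|lb].
  case: (eqVneq l i) => [lE|_]; rewrite ?lE ?eqxx ?cE /= ?eqxx ?cE /=.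
    by rewrite natrB ?(ltnW ji) // mulr1n; ring.
  case: (eqVneq l c) => [lE|_]; rewrite ?lE ?eqxx ?cE /= ?eqxx ?andbF /=
    ?mulr1n; ring.
move/eqP: lb.
case: (eqVneq l i) => [lE|_]; case: (eqVneq b i) => [bE|_];
  rewrite ?lE ?bE ?eqxx ?cE //=;
  case: (eqVneq l c) => [lE'|_]; case: (eqVneq b c) => [bE'|_];
    rewrite ?lE' ?bE' ?eqxx ?cE //=;
  case: (eqVneq l j) => [lE''|_]; case: (eqVneq b j) => [bE''|_];
    rewrite ?lE'' ?bE'' ?eqxx ?cE //= => _;
    rewrite ?mulr0n ?andbF /=; ring.
Qed.

Lemma pair_cov_graph :
  concentration_graph (pair_cov R c e) = parent_graph (pair_parent c e).
Proof. exact: tree_model_graph pair_cov_innov. Qed.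

Lemma pair_cov_tree : tree_covariance (pair_cov R c e).
Proof.
split.
  apply: tree_model_posdef pair_cov_innov _ => //.
  apply/matrixP => a b; rewrite !mxE eq_sym orbC.
  by case: eqVneq => [->|].
rewrite pair_cov_graph.
apply: (@parent_graph_tree _ c _
  (fun l => if l == c then 0 else if l == e.2 then 2 else 1)%N) => // l lc.
rewrite (negbTE lc) /pair_parent; case: (eqVneq l e.2) => [le|_]; last by rewrite eqxx.
case/orP: ce => [/eqP eE|/and3P[ji jc ic]]; first by rewrite le eE eqxx in lc.
by rewrite (negbTE jc); case: eqVneq => // E; rewrite E ltnn in ji.
Qed.

End PairCov.

Lemma pair_covE (R : realType) (n : nat) (c : 'I_n) (e ab : 'I_n * 'I_n) :
  ab != e -> (ab.2, ab.1) != e ->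
  pair_cov R c (c, c) ab.1 ab.2 = pair_cov R c e ab.1 ab.2.
Proof.
case: ab => a b /= abe bae; rewrite !mxE (negbTE abe) (negbTE bae) /=.
case: eqVneq => // ab; rewrite !xpair_eqE.
by case: (eqVneq a c) ab => [->|] //=; case: (eqVneq b c); rewrite ?andbF.
Qed.

Lemma star_covE (R : realType) (n : nat) (c c' : 'I_n) (ab : 'I_n * 'I_n) :
  ab != (c, c) -> ab != (c', c') ->
  pair_cov R c (c, c) ab.1 ab.2 = pair_cov R c' (c', c') ab.1 ab.2.
Proof.
case: ab => a b; rewrite !mxE /= !xpair_eqE.
have [->|ab] := eqVneq a b; first by rewrite !andbb => /negbTE-> /negbTE->.
have F d : (a == d) && (b == d) = false.
  by apply: contraNF ab => /andP[/eqP-> /eqP->].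
by rewrite ![(b == _) && _]andbC !F.
Qed.

Lemma star_graph_neq_pair (n : nat) (c : 'I_n) (e : 'I_n * 'I_n) :
  leaf_pair c e ->
  parent_graph (pair_parent c (c, c)) <> parent_graph (pair_parent c e).
Proof.
case: e => j i /and3P[/= ji jc ic] /setP/(_ (i, j)).
rewrite !inE /pair_parent /= eqxx (negbTE ic) (negbTE jc) eqxx.
rewrite [c == i]eq_sym [c == j]eq_sym (negbTE ic) (negbTE jc) /= andbF andbT.
by move/esym/negbFE/eqP => E; rewrite E ltnn in ji.
Qed.

(** A third vertex is adjacent to [c] in the first star but not in the second; on two vertices the
    stars coincide. *)
Lemma star_graph_inj (n : nat) (c c' : 'I_n) : (2 < n)%N ->
  parent_graph (pair_parent c (c, c)) = parent_graph (pair_parent c' (c', c')) ->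
  c = c'.
Proof.
move=> n2 /setP E; apply: contrapT => /eqP cc'.
have : (0 < #|~: [set c; c']|)%N.
  by rewrite cardsCs finset.setCK cards2 card_ord cc' subn_gt0.
case/card_gt0P => l; rewrite !inE negb_or => /andP[lc lc'].
have := E (c, l); rewrite !inE /pair_parent /= !if_same.
by rewrite ![_ == l]eq_sym [c' == c]eq_sym lc (negbTE lc') (negbTE cc') eqxx orbT.
Qed.

(** * Entries read by a deterministic strategy *)

Section Runs.
Variables (R : realType) (n : nat).
Implicit Types (S : 'M[R]_n) (s : strategy R n).

Fixpoint run S s : seq ('I_n * 'I_n) :=
  match s with
  | Output _ => [::]
  | Query i j next => (i, j) :: run S (next (S i j))
  end.

Lemma size_run S s : size (run S s) = queries S s.
Proof. by elim: s => //= i j next IH; rewrite IH. Qed.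

Lemma eq_output S S' s :
  (forall ab, ab \in run S s -> S ab.1 ab.2 = S' ab.1 ab.2) ->
  output S s = output S' s.
Proof.
elim: s => //= i j next IH eqS.
rewrite -(eqS (i, j)) ?mem_head //=; apply: IH => ab abin.
by apply: eqS; rewrite inE abin orbT.
Qed.

(* Up to the first query of one of the two diagonal entries, both runs agree. *)
Lemma star_outputs_differ (c c' : 'I_n) s :
  output (pair_cov R c (c, c)) s <> output (pair_cov R c' (c', c')) s ->
  (c', c') \in run (pair_cov R c (c, c)) s \/
  (c, c) \in run (pair_cov R c' (c', c')) s.
Proof.
elim: s => //= i j next IH.
have [-> _|ijc] := eqVneq (i, j) (c, c); first by right; rewrite mem_head.
have [-> _|ijc'] := eqVneq (i, j) (c', c'); first by left; rewrite mem_head.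
have /= <- := star_covE R ijc ijc'.
by case/IH => cin; [left|right]; rewrite inE cin orbT.
Qed.

(** By symmetry [(i, j)] and [(j, i)] reveal the same covariance; the increasing order matches
    [leaf_pair], and diagonal pairs are fixed. *)
Definition unordered (ab : 'I_n * 'I_n) : 'I_n * 'I_n :=
  if (ab.1 < ab.2)%N then ab else (ab.2, ab.1).

Lemma pair_output_untouched (c : 'I_n) (e : 'I_n * 'I_n) s :
  leaf_pair c e ->
  e \notin map unordered (run (pair_cov R c (c, c)) s) ->
  output (pair_cov R c (c, c)) s = output (pair_cov R c e) s.
Proof.
move=> /and3P[je _ _] /mapP eN; apply: eq_output => ab abin.
apply: pair_covE; apply/eqP => E; apply: eN; exists ab => //.
  by rewrite /unordered E je.
rewrite /unordered -E /=; case: ltnP => // ab12.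
by move: je; rewrite -E /= ltnNge ltnW.
Qed.

End Runs.

(** * Counting the errors of a deterministic strategy *)

Section Counting.
Variables (R : realType) (n k : nat) (s : strategy R n).
Let star_cov (c : 'I_n) : 'M[R]_n := pair_cov R c (c, c).
Hypothesis queries_le : forall c, (queries (star_cov c) s <= k)%N.

Definition errs (S : 'M[R]_n) : bool :=
  `[< tree_graph (output S s) <> concentration_graph S >].

Let correct : {set 'I_n} := [set c | ~~ errs (star_cov c)]%SET.

Let touched (c : 'I_n) (e : 'I_n * 'I_n) : bool :=
  e \in map (@unordered n) (run (star_cov c) s).

Let edge_touches (c : 'I_n) : nat :=
  #|[set e : 'I_n * 'I_n | leaf_pair c e && touched c e]%SET|.

Let diag_touches (c : 'I_n) : nat :=
  #|[set c' : 'I_n | (c' != c) && touched c (c', c')]%SET|.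

(** Leaf pairs are strictly increasing and hence never diagonal, so the two kinds of touched entries
    share the budget of [k] queries. *)
Let touches_le c : (edge_touches c + diag_touches c <= k)%N.
Proof.
apply: leq_trans (queries_le c); rewrite -size_run -(size_map (@unordered n)).
apply: leq_trans (card_size _).
rewrite /diag_touches -(card_imset _ (f := fun c' : 'I_n => (c', c'))); last by move=> x y [].
rewrite -cardsUI.
rewrite (_ : (_ :&: _)%SET = finset.set0); last first.
  apply/setP => -[a b]; rewrite !inE; apply/negP => /andP[/andP[/andP[/= ab _] _]].
  by move/imsetP => [x _ [ax bx]]; rewrite ax bx ltnn in ab.
rewrite cards0 addn0; apply: subset_leq_card; apply/fintype.subsetP => e.
by rewrite !inE => /orP[/andP[]//|/imsetP[x]]; rewrite inE => /andP[_ ?] ->.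
Qed.

Let tournament c c' : (2 < n)%N -> c \in correct -> c' \in correct -> c != c' ->
  touched c (c', c') || touched c' (c, c).
Proof.
rewrite !inE => n2 /asboolPn/contrapT oc /asboolPn/contrapT oc' cc'.
have diagT a b : (a, a) \in run (star_cov b) s -> touched b (a, a).
  by move=> ain; apply/mapP; exists (a, a) => //; rewrite /unordered if_same.
have [|/diagT->//|/diagT->] := @star_outputs_differ R n c c' s; last by rewrite orbT.
move=> E; move: oc oc'; rewrite /star_cov E => ->.
rewrite !pair_cov_graph ?eqxx // => /(star_graph_inj n2) cE.
by rewrite cE eqxx in cc'.
Qed.

(** By [tournament], each ordered pair of distinct correct centres accounts for a diagonal touch,
    and each touch serves both orders of its pair. *)
Let sum_diag_touches : (2 < n)%N ->
  (#|correct| * (#|correct|.-1) <= 2 * \sum_(c in correct) diag_touches c)%N.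
Proof.
move=> n2; rewrite mul2n -addnn.
have E c : c \in correct -> (diag_touches c >=
    \sum_(c' in correct | c' != c) touched c (c', c'))%N.
  move=> _; rewrite /diag_touches -sum1dep_card.
  rewrite [leqRHS]big_mkcond [leqLHS]big_mkcond /=; apply: leq_sum => c' _.
  by case: (c' \in correct); case: (c' != c) => //=; case: touched.
apply: (@leq_trans (\sum_(c in correct) \sum_(c' in correct | c' != c)
   (touched c (c', c') + touched c' (c, c)))%N).
  rewrite -sum_nat_const; apply: leq_sum => c cin.
  rewrite (cardsD1 c) cin /= add0n -sum1_card.
  under eq_bigl do rewrite in_setD1 andbC.
  apply: leq_sum => c' /andP[c'in c'c].
  have := tournament n2 cin c'in; rewrite eq_sym c'c => /(_ isT).
  by case: touched; case: touched.
under eq_bigr do rewrite big_split /=.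
rewrite big_split leq_add //=; first by apply: leq_sum.
rewrite (exchange_big_dep (mem correct)) /=; last by move=> ? ? ? /andP[].
apply: leq_sum => c cin; apply: leq_trans (E c cin).
by under eq_bigl do rewrite cin eq_sym.
Qed.

(** Each modification is paired with its own star, so a star counts once per leaf pair. A pair of
    models escapes error only if the star is correct and the moved entry is touched; [Q] counts
    these escapes. *)
Lemma weighted_errors_ge (m : nat) : n = m.+1 -> (1 < m)%N -> (2 * k <= m ^ 2)%N ->
  (m * #|[set x : 'I_n * ('I_n * 'I_n) | leaf_pair x.1 x.2]%SET| <=
   m * \sum_(x : 'I_n * ('I_n * 'I_n) | leaf_pair x.1 x.2)
         (errs (star_cov x.1) + errs (pair_cov R x.1 x.2)) + k * (m ^ 2 - 1))%N.
Proof.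
move=> nm m1 km.
have n2 : (2 < n)%N by rewrite nm.
pose Q := (\sum_(c in correct) edge_touches c)%N.
(* With [a] correct stars, [Q <= a * k - a * (a - 1) / 2]. For [a <= m - 1] the bound [a * k]
   suffices; for [a = m] and [a = m + 1] the wasted queries are used together with [2 * k <= m ^ 2],
   which is exactly what [a = m + 1] demands. *)
have mQ : (m * Q <= k * (m ^ 2 - 1))%N.
  have an : (#|correct| <= m.+1)%N by rewrite -nm -[leqRHS]card_ord max_card.
  have := sum_diag_touches n2.
  have : (Q + \sum_(c in correct) diag_touches c <= #|correct| * k)%N.
    by rewrite -big_split -sum_nat_const; apply: leq_sum.
  move: (\sum_(c in correct) diag_touches c)%N #|correct| an => T a am.
  move: Q => Q QT aT.
  have [am1|am1] := leqP a m.-1.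
    nia.
  have [aE|aE] : a = m \/ a = m.+1 by lia.
    nia.
  nia.
apply: leq_trans (leq_add (leqnn _) mQ); rewrite -mulnDr leq_mul2l; apply/orP; right.
have -> : Q = (\sum_(x : 'I_n * ('I_n * 'I_n) | leaf_pair x.1 x.2)
    ((x.1 \in correct) && touched x.1 x.2))%N.
  rewrite /Q -(pair_big_dep predT (fun c e => leaf_pair c e)
    (fun c e => nat_of_bool ((c \in correct) && touched c e))) /=.
  rewrite big_mkcond; apply: eq_bigr => c _; case: (c \in correct) => /=.
    rewrite /edge_touches -sum1dep_card big_mkcondr /=.
    by apply: eq_bigr => e _; case: touched.
  by rewrite big1.
rewrite -big_split -sum1dep_card /=; apply: leq_sum => -[c e] /= ce.
rewrite inE; case: (boolP (errs (star_cov c))) => //= /asboolPn/contrapT oc.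
case: (boolP (touched c e)) => [|/(pair_output_untouched ce) oE]; first by rewrite addn1.
rewrite /errs -oE oc !pair_cov_graph ?eqxx ?ce ?orbT //.
by case: asboolP => // -[]; exact: star_graph_neq_pair.
Qed.

End Counting.

(** * From error counts to the minimax risk *)

(** The averaging step of Yao's principle: a bound on the number of errors valid for every seed is
    integrated over the seed. *)
Lemma sum_probability_ge (R : realType) (d : measure_display)
    (T : measurableType d) (P : probability T R) (I : finType) (Q : pred I)
    (E : I -> set T) (r : R) :
  (forall i, Q i -> measurable (E i)) ->
  (forall w, r <= \sum_(i | Q i) (`[< E i w >])%:R) ->
  (r%:E <= \sum_(i | Q i) P (E i))%E.
Proof.
move=> mE rE; have [r0|r0] := leP 0 r; last first.
  apply: (@le_trans _ _ 0%E); first by rewrite lee_fin ltW.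
  by apply: sume_ge0 => i _; exact: measure_ge0.
(* Measurability is known only for indices in [Q]; the other events are replaced by the empty
   set. *)
pose F i := if Q i then E i else set0.
have mF i : measurable (F i) by rewrite /F; case: ifPn => [/mE|_].
have mf i : measurable_fun setT (EFin \o (\1_(F i) : T -> R)).
  exact/measurable_EFinP/measurable_indic.
have -> : (\sum_(i | Q i) P (E i) = \int[P]_w \sum_(i : I) (\1_(F i) w)%:E)%E.
  rewrite ge0_integral_sum //.
  rewrite big_mkcond; apply: eq_bigr => i _.
  by rewrite integral_indic // setIT /F; case: ifP => //; rewrite measure0.
have -> : r%:E = (\int[P]_w cst r%:E w)%E.
  by rewrite integral_cst //= probability_setT mule1.
apply: ge0_le_integral => //.
  by apply: emeasurable_sum => i; exact: mf.
move=> w _ /=; rewrite sumEFin lee_fin; apply: le_trans (rE w) _.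
rewrite big_mkcond; apply: ler_sum => i _; rewrite /F indicE.
case: (Q i); last by rewrite in_set0.
by case: asboolP => // /mem_set ->.
Qed.

Lemma card_leaf_pair (n : nat) (c : 'I_n.+1) :
  (2 * #|[set e | leaf_pair c e]%SET| = n * n.-1)%N.
Proof.
pose lt (a b : 'I_n.+1) : nat := [&& (a < b)%N, a != c & b != c].
have cardE : #|[set e | leaf_pair c e]%SET| = (\sum_a \sum_b lt a b)%N.
  by rewrite pair_big -sum1dep_card big_mkcond /=; apply: eq_bigr => e _; rewrite /lt /leaf_pair; case: ifP.
have sum_c : (\sum_(a : 'I_n.+1) (a != c) = n)%N.
  by rewrite -big_mkcond sum1_card cardC1 card_ord.
have sum_cc : (\sum_(a : 'I_n.+1) \sum_b (a != c) * (b != c) = n * n)%N.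
  under eq_bigr do rewrite -big_distrr sum_c.
  by rewrite -big_distrl sum_c.
(* The [n ^ 2] ordered pairs of non-central vertices split into increasing, decreasing and diagonal
   ones. *)
have : (\sum_(a : 'I_n.+1) \sum_b (a != c) * (b != c) =
    \sum_a \sum_b lt a b + \sum_a \sum_b lt b a
    + \sum_(a : 'I_n.+1) (a != c))%N.
  rewrite -!big_split; apply: eq_bigr => a _ /=.
  rewrite -big_split (bigD1 a) //= [X in _ = (X + _)%N](bigD1 a) //=.
  rewrite {1 2}/lt ltnn mulnb andbb add0n addnC; congr addn.
  apply: eq_bigr => b ba; rewrite mulnb /lt.
  have : (val b != val a) by [].
  by case: (a != c); case: (b != c); rewrite ?andbF //=; case: ltngtP.
rewrite sum_cc sum_c [X in (_ + X + _)%N]exchange_big /= -cardE.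
move: #|_| => x; case: (n) => [|n']; nia.
Qed.

Lemma max_risk_ge0 (R : realType) (n : nat) (A : rand_algorithm R n) :
  (0 < n)%N -> (0 <= max_risk A)%E.
Proof.
move=> n0; pose c := Ordinal n0; pose S := pair_cov R c (c, c).
apply: (@le_trans _ _ (error_prob A S)); first exact: measure_ge0.
by apply: ereal_sup_ubound; exists S => //; apply: pair_cov_tree; rewrite eqxx.
Qed.

Lemma max_risk_ge (R : realType) (m k : nat) (A : rand_algorithm R m.+1) :
  (1 < m)%N -> (2 * k <= m ^ 2)%N -> algorithm_class k A ->
  ((2^-1 - k%:R / m%:R ^+ 2)%:E <= max_risk A)%E.
Proof.
move=> m1 km kA.
pose I := ('I_m.+1 * ('I_m.+1 * 'I_m.+1))%type.
pose S (bx : bool * I) : 'M[R]_m.+1 :=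
  pair_cov R bx.2.1 (if bx.1 then bx.2.2 else (bx.2.1, bx.2.1)).
pose Q (bx : bool * I) := leaf_pair bx.2.1 bx.2.2.
have treeS bx : Q bx -> tree_covariance (S bx).
  move=> Qbx; apply: pair_cov_tree.
  by case: ifP; rewrite ?eqxx // [leaf_pair _ _]Qbx orbT.
pose E (bx : bool * I) : set (seed A) :=
  [set w | tree_graph (output (S bx) (strategy_of w)) <> concentration_graph (S bx)].
have mE bx : Q bx -> measurable (E bx).
  move=> /treeS Sbx; apply: measurableC.
  exact: (output_measurable A Sbx (concentration_graph (S bx))).
have splitQ (G : bool * I -> R) : \sum_(bx | Q bx) G bx =
    \sum_(x : I | leaf_pair x.1 x.2) (G (false, x) + G (true, x)).
  transitivity (\sum_(b : bool) \sum_(x : I | leaf_pair x.1 x.2) G (b, x)).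
    by rewrite pair_big_dep /=; apply: eq_bigr => -[].
  by rewrite big_bool big_split /= addrC.
pose F := #|[set x : I | leaf_pair x.1 x.2]%SET|.
have FE : (2 * F = m.+1 * (m * m.-1))%N.
  rewrite /F -sum1dep_card.
  rewrite -(pair_big_dep predT (fun c e => leaf_pair c e) (fun _ _ => 1%N)) /=.
  rewrite big_distrr /= -[X in (X * _)%N]card_ord -sum_nat_const.
  by apply: eq_bigr => c _; rewrite sum1dep_card card_leaf_pair.
have m_gt0 : (0 < m%:R :> R) by rewrite ltr0n; lia.
pose r : R := F%:R - k%:R * (m%:R ^+ 2 - 1) / m%:R.
have pointwise w : r <= \sum_(bx | Q bx) (`[< E bx w >])%:R.
  have queries_le c :
      (queries (pair_cov R c (c, c)) (strategy_of w) <= k)%N.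
    by apply: kA; apply: pair_cov_tree; rewrite eqxx.
  have := weighted_errors_ge queries_le erefl m1 km.
  rewrite -(ler_nat R) natrD !natrM natrB ?expn_gt0 ?(ltnW m1) // natrX -/F.
  rewrite splitQ raddf_sum /=.
  under eq_bigr do rewrite natrD.
  set W := \sum_(x | _) _ => le_mW.
  rewrite -(ler_pM2l m_gt0) mulrBr lerBlDr.
  by rewrite [m%:R * (_ / _)]mulrC divfK ?lt0r_neq0.
have sumP := sum_probability_ge (seed_law A) mE pointwise.
have errM bx : Q bx -> (seed_law A (E bx) <= max_risk A)%E.
  by move=> /treeS Sbx; apply: ereal_sup_ubound; exists (S bx).
have {sumP} := le_trans sumP (lee_sum _ errM).
have := max_risk_ge0 A (ltn0Sn m).
case: (max_risk A) => // [M _|_]; last by rewrite leey.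
rewrite sumEFin !lee_fin splitQ sumr_const.
rewrite (_ : #|_| = F); last by apply: eq_card => x; rewrite [RHS]inE.
(* Since [2 * F = m * (m ^ 2 - 1)], the loss [k * (m ^ 2 - 1) / m] in [r] equals
   [2 * F * k / m ^ 2]. *)
have -> : r = (2 * F)%:R * (2^-1 - k%:R / m%:R ^+ 2).
  rewrite mulrBr {1}natrM mulrC mulKf ?pnatr_eq0 // FE /r; congr (_ - _).
  case: (m) m_gt0 m1 => // m' m'0 _; field.
  by rewrite /= in m'0; rewrite lt0r_neq0.
rewrite (_ : (M + M) *+ F = (2 * F)%:R * M); last by rewrite natrM -mulr_natr; ring.
by rewrite ler_pM2l // ltr0n FE !muln_gt0 /=; lia.
Qed.

(** On two vertices there is only one tree, so without queries the risk is 0 while the left-hand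
    side is 1/2. For [n = 1] division by zero would also make the left-hand side 1/2. *)
Lemma minimax_risk_ge (R : realType) (n k : nat) :
  (1 < n)%N -> (n, k) <> (2%N, 0%N) ->
  ((2^-1 - k%:R / (n%:R - 1) ^+ 2)%:E <= minimax_risk R n k)%E.
Proof.
case: n => // m m_gt0 nk; apply: le_ereal_inf_tmp => _ [A kA ->].
rewrite [_ - 1](_ : _ = m%:R); last by rewrite -natr1 addrK.
have [km|km] := leqP (2 * k) (m ^ 2).
  apply: max_risk_ge => //; case: m m_gt0 nk km {A kA} => // -[|//] _ nk.
  by case: k nk => // -[].
(* Here [2 * k > m ^ 2], so the claimed bound is negative. *)
apply: le_trans (max_risk_ge0 A (ltn0Sn m)); rewrite lee_fin subr_le0.
have m2 : 0 < m%:R ^+ 2 :> R by rewrite exprn_gt0 // ltr0n.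
rewrite ler_pdivlMr // ler_pdivrMl //.
by rewrite -natrX -natrM ler_nat ltnW.
Qed.

Theorem theorem15 (R : realType) :
  (forall n k : nat, (1 < n)%N -> (n, k) <> (2%N, 0%N) -> (k <= 'C(n, 2))%N ->
     ((2^-1 - k%:R / (n%:R - 1) ^+ 2)%:E <= minimax_risk R n k)%E) /\
  (forall k : nat -> nat,
     (fun n => (k n)%:R : R^o) =o_\oo (fun n => n%:R ^+ 2 : R^o) ->
     exists2 e : nat -> R^o, e =o_\oo (fun=> 1 : R^o) &
       \forall n \near \oo, ((2^-1 - e n)%:E <= minimax_risk R n (k n))%E).
Proof.
split=> [n k n1 nk _|k /eqoP ko]; first exact: minimax_risk_ge.
exists (fun n => (k n)%:R / (n%:R - 1) ^+ 2); last first.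
  near=> n; have n3 : (2 < n)%N by near: n; exact: nbhs_infty_gt.
  by apply: minimax_risk_ge; [exact: ltnW|case=> nE; rewrite nE in n3].
apply/eqoP => eps eps0.
near=> n; have n3 : (2 < n)%N by near: n; exact: nbhs_infty_gt.
(* The factor 4 pays for replacing [n] by [n - 1]: [n ^ 2 <= 4 * (n - 1) ^ 2] once [n >= 2]. *)
have : `|(k n)%:R : R^o| <= eps / 4 * `|n%:R ^+ 2 : R^o|.
  by near: n; apply: ko; rewrite divr_gt0.
have n3R : 3 <= n%:R :> R by rewrite ler_nat.
rewrite normr1 mulr1 !ger0_norm ?divr_ge0 ?sqr_ge0 // => kn.
rewrite ler_pdivrMr; last by rewrite exprn_gt0 // subr_gt0; lra.
apply: le_trans kn _; rewrite -mulrA ler_pM2l // ler_pdivrMl //.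
by nra.
Unshelve. all: by end_near.
Qed.
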